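(* Let $R$ and $S$ be $F$-finite noetherian $\mathbb{F}_p$-algebras and $f\colon\operatorname{Spec}S\to\operatorname{Spec}R$ a finite dominant morphism. Let $\mathcal{C}$ be a Cartier $R$-algebra and $M$ a Cartier $\mathcal{C}$-module. Then $$\operatorname{Tr}_M\big(f_*\sigma(f^!M,f^*\mathcal{C})\big)\subset\sigma(M,\mathcal{C}),$$ and equality holds if $\operatorname{Tr}_M\colon f_*f^!M\to M$ is surjective.
   Context: $q=p^e$. A Cartier $R$-algebra is an $\mathbb{N}$-graded ring $\mathcal{C}=\bigoplus_{e\ge0}\mathcal{C}_e$ with $\mathcal{C}_0=R$ and $r\cdot\kappa=\kappa\cdot r^{q}$ for $r\in R$, $\kappa\in\mathcal{C}_e$; $\mathcal{C}_+=\bigoplus_{e\ge1}\mathcal{C}_e$. A Cartier $\mathcal{C}$-module is a left $\mathcal{C}$-module that is finitely generated over $R$. $f^*\mathcal{C}=\bigoplus_e\mathcal{C}_e\otimes_RS$ is the Cartier $S$-algebra with $s\cdot(\kappa_e\otimes s')=\kappa_e\otimes s^{q}s'$; it acts on $f^!M=\operatorname{Hom}_R(S,M)$ by $\big((\kappa_e\otimes s')\cdot\mu\big)(s)=\kappa_e\cdot\mu(s's^{q})$. $\operatorname{Tr}_M\colon f_*f^!M\to M$ is $\mu\mapsto\mu(1)$. For a Cartier module $(M,\mathcal{C})$ the chain $\mathcal{C}_+M\supset\mathcal{C}_+^2M\supset\cdots$ stabilizes (known), and the non-$F$-pure module is the stable image $\sigma(M,\mathcal{C})=\mathcal{C}_+^eM$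 for $e\gg0$, where $\mathcal{C}_+^e=(\mathcal{C}_+)^e$. *)

(* Defs.v *)
From HB Require Import structures.
From mathcomp Require Import all_boot all_order all_algebra.
From mathcomp Require Import boolp classical_sets functions.
Set Implicit Arguments.
Unset Strict Implicit.
Unset Printing Implicit Defensive.
Import GRing.Theory.
Local Open Scope ring_scope.
Local Open Scope quotient_scope.

(* Rings are [comPzRingType]: the zero ring (empty spectrum) is allowed.      *)

Definition Fp_algebra (p : nat) (A : comPzRingType) : Prop :=
  prime p /\ p%:R = 0 :> A.

Definition ideal (A : comPzRingType) (I : set A) : Prop :=
  [/\ I 0, forall x y, I x -> I y -> I (x + y) & forall a x, I x -> I (a * x)].

Definition prime_ideal (A : comPzRingType) (P : set A) : Prop :=
  [/\ ideal P, ~ P 1 & forall x y, P (x * y) -> P x \/ P y].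

Definition noetherian (A : comPzRingType) : Prop :=
  forall I : set A, ideal I ->
    exists (n : nat) (g : 'I_n -> A),
      I = [set x | exists a : 'I_n -> A, x = \sum_i a i * g i]%classic.

(* [h : A -> B] makes [B] a finitely generated [A]-module; [h] is a bare      *)
(* function so that it can also be the Frobenius.                             *)
Definition finite_map (A B : comPzRingType) (h : A -> B) : Prop :=
  exists (n : nat) (g : 'I_n -> B), forall b,
    exists a : 'I_n -> A, b = \sum_i h (a i) * g i.

Definition F_finite (p : nat) (A : comPzRingType) : Prop :=
  finite_map (fun x : A => x ^+ p).

Definition Spec (A : comPzRingType) : set (set A) := [set P | prime_ideal P]%classic.

Definition zariski_closed (A : comPzRingType) (E : set A) : set (set A) :=
  [set P | Spec P /\ (E `<=` P)]%classic.

(* Density of the image of [Spec S -> Spec R]: the only Zariski closed subset *)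
(* of [Spec R] containing it is [Spec R].                                     *)
Definition dominant (R S : comPzRingType) (f : R -> S) : Prop :=
  forall E : set R,
    ([set f @^-1` Q | Q in @Spec S] `<=` zariski_closed E)%classic ->
    (@Spec R `<=` zariski_closed E)%classic.

(* The three fields [cgrade_zmod], [cgrade_gen] and [cgrade_direct] say that  *)
(* the ring is the internal direct sum of the additive subgroups [cgrade e].  *)
(* It is not an [R]-algebra in the usual sense: [cscal R] is not central.     *)
Record cartierAlgebra (p : nat) (R : comPzRingType) := CartierAlgebra {
  cring :> pzRingType;
  cgrade : nat -> {pred cring};
  cscal : {rmorphism R -> cring};
  cgrade_zmod : forall e, zmod_closed (cgrade e);
  cgrade_gen : forall x, exists (n : nat) (c : nat -> cring),
    (forall e, c e \in cgrade e) /\ x = \sum_(0 <= e < n) c e;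
  cgrade_direct : forall (n : nat) (c : nat -> cring),
    (forall e, c e \in cgrade e) -> \sum_(0 <= e < n) c e = 0 ->
    forall e, (e < n)%N -> c e = 0;
  cgradeM : forall d e x y,
    x \in cgrade d -> y \in cgrade e -> x * y \in cgrade (d + e)%N;
  cscal_inj : injective cscal;
  cscal_grade0 : forall x, x \in cgrade 0 <-> exists r, x = cscal r;
  cscal_comm : forall e r k,
    k \in cgrade e -> cscal r * k = k * cscal (r ^+ (p ^ e))
}.

Arguments cgrade {p R} _ _.
Arguments cscal {p R} _.

Section NonFPure.
Variables (p : nat) (R : comPzRingType) (C : cartierAlgebra p R).

Definition cplus : set C :=
  [set x | exists (n : nat) (c : nat -> C),
     (forall e, c e \in cgrade C e) /\ x = \sum_(1 <= e < n) c e]%classic.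

Definition mulset (A B : set C) : set C :=
  [set x | exists (n : nat) (a b : 'I_n -> C),
     (forall i, A (a i) /\ B (b i)) /\ x = \sum_i a i * b i]%classic.

Fixpoint cplus_pow (e : nat) : set C :=
  if e is e'.+1 then mulset cplus (cplus_pow e') else setT.

Variable M : lmodType C.

Definition fin_gen_over_base : Prop :=
  exists (n : nat) (g : 'I_n -> M), forall m,
    exists a : 'I_n -> R, m = \sum_i cscal C (a i) *: g i.

Definition actset (A : set C) (N : set M) : set M :=
  [set x | exists (n : nat) (a : 'I_n -> C) (m : 'I_n -> M),
     (forall i, A (a i) /\ N (m i)) /\ x = \sum_i a i *: m i]%classic.

(* The elements of [C_+^e M] for all large [e]: the stable value of the chain *)
(* as soon as it stabilizes (see [sigma_stable]).                             *)
Definition sigma : set M :=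
  [set m | exists e0, forall e, (e0 <= e)%N ->
     actset (cplus_pow e) setT m]%classic.

Lemma sigma_stable (e0 : nat) :
  (forall e, (e0 <= e)%N ->
     actset (cplus_pow e) setT = actset (cplus_pow e0) setT) ->
  sigma = actset (cplus_pow e0) setT.
Proof.
move=> st; apply/seteqP; split=> m /=.
  by case=> e1 /(_ (maxn e0 e1) (leq_maxr _ _)); rewrite st ?leq_maxl.
by move=> me0; exists e0 => e le; rewrite st.
Qed.

End NonFPure.

Arguments sigma {p R} C M.

Section Pullback.
Variables (p : nat) (R S : comPzRingType) (f : {rmorphism R -> S}).
Variable C : cartierAlgebra p R.

(* Symbols [k (x) s] with [k] homogeneous, recorded with its degree.          *)
Definition tsym : Type :=
  {t : nat * C * S | t.1.2 \in cgrade C t.1.1}.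

Definition tsym_of e k s (hk : k \in cgrade C e) : tsym :=
  exist (fun t : nat * C * S => t.1.2 \in cgrade C t.1.1) (e, k, s) hk.

(* Sequences of symbols stand for formal sums; this is the congruence whose   *)
(* quotient is the direct sum over [e] of the tensor products [C_e (x)_R S],  *)
(* for the right [R]-module structure of [C_e].                               *)
Inductive tens_rel : seq tsym -> seq tsym -> Prop :=
| TensRefl l : tens_rel l l
| TensSym l l' : tens_rel l l' -> tens_rel l' l
| TensTrans l l' l'' : tens_rel l l' -> tens_rel l' l'' -> tens_rel l l''
| TensCat l1 l2 l1' l2' :
    tens_rel l1 l1' -> tens_rel l2 l2' -> tens_rel (l1 ++ l2) (l1' ++ l2')
| TensComm l1 l2 : tens_rel (l1 ++ l2) (l2 ++ l1)
| Tens0 e s (h0 : 0 \in cgrade C e) : tens_rel [:: tsym_of s h0] [::]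
| TensDl e k k' s (hk : k \in cgrade C e) (hk' : k' \in cgrade C e)
    (hkk' : k + k' \in cgrade C e) :
    tens_rel [:: tsym_of s hkk'] [:: tsym_of s hk; tsym_of s hk']
| TensDr e k s s' (hk : k \in cgrade C e) :
    tens_rel [:: tsym_of (s + s') hk] [:: tsym_of s hk; tsym_of s' hk]
| TensBal e k r s (hk : k \in cgrade C e)
    (hkr : k * cscal C r \in cgrade C e) :
    tens_rel [:: tsym_of s hkr] [:: tsym_of (f r * s) hk].

Definition tens_eq (l l' : seq tsym) : bool := `[< tens_rel l l' >].

Lemma tens_eq_refl : reflexive tens_eq.
Proof. by move=> l; apply/asboolP; apply: TensRefl. Qed.

Lemma tens_eq_sym : symmetric tens_eq.
Proof. by move=> l l'; apply/asboolP/asboolP => /TensSym. Qed.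

Lemma tens_eq_trans : transitive tens_eq.
Proof.
by move=> l l' l'' /asboolP h /asboolP h'; apply/asboolP; apply: TensTrans h h'.
Qed.

Canonical tens_equiv : equiv_rel (seq tsym) :=
  EquivRel tens_eq tens_eq_refl tens_eq_sym tens_eq_trans.

Definition pullback : Type := {eq_quot tens_eq}.

HB.instance Definition _ : EqQuotient _ tens_eq pullback := EqQuotient.on pullback.
HB.instance Definition _ := Choice.on pullback.

Definition tcl (l : seq tsym) : pullback := \pi_pullback l.

Lemma tclP l l' : tens_rel l l' -> tcl l = tcl l'.
Proof. by move=> h; apply/eqP; rewrite eqmodE /=; apply/asboolP. Qed.

Lemma tcl_rel l l' : tcl l = tcl l' -> tens_rel l l'.
Proof. by move/eqP; rewrite eqmodE /= => /asboolP. Qed.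

Lemma tclK (x : pullback) : tcl (repr x) = x.
Proof. exact: reprK. Qed.

Lemma repr_tcl l : tens_rel (repr (tcl l)) l.
Proof. by apply: tcl_rel; rewrite tclK. Qed.

Lemma cgrade0 e : 0 \in cgrade C e.
Proof. by have [] := cgrade_zmod C e. Qed.

Lemma cgradeB e x y :
  x \in cgrade C e -> y \in cgrade C e -> x - y \in cgrade C e.
Proof. by have [_ h] := cgrade_zmod C e; apply: h. Qed.

Lemma cgradeN e x : x \in cgrade C e -> - x \in cgrade C e.
Proof. by move=> hx; rewrite -sub0r; apply: cgradeB => //; apply: cgrade0. Qed.

Lemma cgradeD e x y :
  x \in cgrade C e -> y \in cgrade C e -> x + y \in cgrade C e.
Proof. by move=> hx hy; rewrite -[y]opprK; apply/cgradeB/cgradeN. Qed.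

Lemma cscal_in0 r : cscal C r \in cgrade C 0.
Proof. by apply/cscal_grade0; exists r. Qed.

Lemma cgradeMr e x r : x \in cgrade C e -> x * cscal C r \in cgrade C e.
Proof. by move=> hx; rewrite -[e]addn0; apply/cgradeM/cscal_in0. Qed.

Definition topp (t : tsym) : tsym :=
  let: exist (e, k, s) hk := t in @tsym_of e (- k) s (cgradeN hk).

Definition padd (x y : pullback) : pullback := tcl (repr x ++ repr y).
Definition popp (x : pullback) : pullback := tcl (map topp (repr x)).

Lemma padd_cl l l' : padd (tcl l) (tcl l') = tcl (l ++ l').
Proof. by apply: tclP; apply: TensCat; apply: repr_tcl. Qed.

Lemma padd_proof :
  [/\ associative padd, commutative padd & left_id (tcl [::]) padd].
Proof.
split.
- move=> x y z; rewrite -[x]tclK -[y]tclK -[z]tclK.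
  by rewrite !padd_cl catA.
- by move=> x y; apply: tclP; apply: TensComm.
- by move=> x; rewrite -[x]tclK padd_cl.
Qed.

Lemma topp_cat l : tens_rel (map topp l ++ l) [::].
Proof.
elim: l => [|t l ih] /=; first exact: TensRefl.
have ht : tens_rel ([:: topp t] ++ [:: t]) [::].
  case: t => [[[e k] s] /= hk].
  have h0 : - k + k \in cgrade C e by rewrite addNr cgrade0.
  apply: TensTrans; first exact/TensSym/(TensDl s (cgradeN hk) hk h0).
  have hz : tens_rel [:: tsym_of s (cgrade0 e)] [::] by apply: Tens0.
  suff -> : tsym_of s h0 = tsym_of s (cgrade0 e) by [].
  by apply: val_inj; rewrite /= addNr.
have -> : topp t :: map topp l ++ t :: l =
          [:: topp t] ++ (map topp l ++ [:: t]) ++ l by rewrite -catA.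
apply: (@TensTrans _ ([:: topp t] ++ ([:: t] ++ map topp l) ++ l)).
  apply: TensCat; first exact: TensRefl.
  by apply: TensCat; [exact: TensComm | exact: TensRefl].
rewrite -catA catA.
by apply: (@TensTrans _ ([::] ++ [::])); [exact: TensCat|exact: TensRefl].
Qed.

Lemma paddN : left_inverse (tcl [::]) popp padd.
Proof. by move=> x; rewrite -{2}[x]tclK padd_cl; apply/tclP/topp_cat. Qed.

HB.instance Definition _ := GRing.isZmodule.Build pullback
  (let: And3 h _ _ := padd_proof in h) (let: And3 _ h _ := padd_proof in h)
  (let: And3 _ _ h := padd_proof in h) paddN.

Lemma tclD l l' : tcl (l ++ l') = tcl l + tcl l'.
Proof. by rewrite [RHS]padd_cl. Qed.

(* The element [k (x) s]; junk value [0] when [k] is not in degree [e].       *)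
Definition tens e (k : C) (s : S) : pullback :=
  if insub (e, k, s) is Some t then tcl [:: t : tsym] else 0.

Lemma tensE e k s (hk : k \in cgrade C e) : tens e k s = tcl [:: tsym_of s hk].
Proof.
rewrite /tens insubT; congr (tcl [:: _]); exact: val_inj.
Qed.

(* Balanced maps extend uniquely to [pullback]: [lift] is additive and sends  *)
(* [k (x) s] to [b e k s] (uniqueness is [tens_ind] below).                   *)
Section Lift.
Variables (A : zmodType) (b : nat -> C -> S -> A).

Definition balanced : Prop := forall e,
  [/\ forall k k' s, k \in cgrade C e -> k' \in cgrade C e ->
        b e (k + k') s = b e k s + b e k' s,
      forall k s s', k \in cgrade C e -> b e k (s + s') = b e k s + b e k s'
    & forall k r s, k \in cgrade C e ->
        b e (k * cscal C r) s = b e k (f r * s)].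

Definition tsum (l : seq tsym) : A :=
  \sum_(t <- l) b (val t).1.1 (val t).1.2 (val t).2.

Definition lift (x : pullback) : A := tsum (repr x).

Hypothesis bal : balanced.

Lemma tsum_rel l l' : tens_rel l l' -> tsum l = tsum l'.
Proof.
rewrite /tsum; elim=> {l l'} //.
- by move=> l l' l'' _ -> _ ->.
- by move=> l1 l2 l1' l2' _ h1 _ h2; rewrite !big_cat /= h1 h2.
- by move=> l1 l2; rewrite !big_cat /= addrC.
- move=> e s h0; rewrite big_seq1 big_nil /=.
  have [h _ _] := bal e; apply: (addrI (b e 0 s)).
  by rewrite -h // !addr0.
- move=> e k k' s hk hk' hkk'; rewrite big_seq1 big_cons big_seq1 /=.
  by have [h _ _] := bal e; apply: h.
- move=> e k s s' hk; rewrite big_seq1 big_cons big_seq1 /=.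
  by have [_ h _] := bal e; apply: h.
- move=> e k r s hk hkr; rewrite !big_seq1 /=.
  by have [_ _ h] := bal e; apply: h.
Qed.

Lemma lift_tcl l : lift (tcl l) = tsum l.
Proof. exact/tsum_rel/repr_tcl. Qed.

Lemma lift_tens e k s : k \in cgrade C e -> lift (tens e k s) = b e k s.
Proof. by move=> hk; rewrite (tensE s hk) lift_tcl /tsum big_seq1. Qed.

Lemma liftD x y : lift (x + y) = lift x + lift y.
Proof.
by rewrite -[x]tclK -[y]tclK -tclD !lift_tcl /tsum big_cat.
Qed.

Lemma lift0 : lift 0 = 0.
Proof. by apply: (addrI (lift 0)); rewrite -liftD !addr0. Qed.

End Lift.

Lemma tens_balanced : balanced tens.
Proof.
move=> e; split.
- move=> k k' s hk hk'; rewrite !(tensE s (cgradeD hk hk'), tensE s hk, tensE s hk').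
  by rewrite -tclD; apply/tclP/TensDl.
- by move=> k s s' hk; rewrite !(tensE _ hk) -tclD; apply/tclP/TensDr.
- move=> k r s hk; rewrite (tensE _ hk) (tensE _ (cgradeMr r hk)).
  exact/tclP/TensBal.
Qed.

Lemma tens_ind (P : pullback -> Prop) :
  P 0 -> (forall x y, P x -> P y -> P (x + y)) ->
  (forall e k s, k \in cgrade C e -> P (tens e k s)) -> forall x, P x.
Proof.
move=> P0 PD Pt x; rewrite -[x]tclK; elim: (repr x) => [|t l ih].
  exact: P0.
rewrite -cat1s tclD; apply: PD => //.
by case: t => [[[e k] s] /= hk]; have := Pt e k s hk; rewrite (tensE s hk).
Qed.

Definition pgrade (e : nat) : {pred pullback} :=
  [pred x | `[< exists (n : nat) (k : 'I_n -> C) (s : 'I_n -> S),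
     (forall i, k i \in cgrade C e) /\ x = \sum_i tens e (k i) (s i) >]].

Hypothesis chS : Fp_algebra p S.

Lemma frobD e (x y : S) : (x + y) ^+ (p ^ e) = x ^+ (p ^ e) + y ^+ (p ^ e).
Proof.
case: chS => pp p0; have fr (u v : S) : (u + v) ^+ p = u ^+ p + v ^+ p.
  rewrite exprDn big_ord_recl subn0 bin0 expr0 mulr1 mulr1n.
  rewrite -(prednK (prime_gt0 pp)) big_ord_recr /= !prednK ?prime_gt0 //.
  rewrite big1 ?add0r => [|i _].
    by rewrite /bump /= add1n prednK ?prime_gt0 // subnn binn expr0 mul1r.
  have : (p %| 'C(p, i.+1))%N.
    by apply: prime_dvd_bin => //=; rewrite -[X in (_ < X)%N](prednK (prime_gt0 pp)) ltnS.
  rewrite /bump /= add1n => /dvdnP[m ->].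
  by rewrite mulnC -mulr_natr natrM p0 mul0r mulr0.
elim: e => [|e ih]; first by rewrite expn0 !expr1.
by rewrite expnSr !exprM ih fr.
Qed.

Definition pmul_inner (d : nat) (k : C) (s : S) (e : nat) (k' : C) (s' : S) :
  pullback := tens (d + e) (k * k') (s ^+ (p ^ e) * s').

Definition pmul (x y : pullback) : pullback :=
  lift (fun d k s => lift (pmul_inner d k s) y) x.

Lemma pmul_inner_balanced d k s : k \in cgrade C d ->
  balanced (pmul_inner d k s).
Proof.
move=> hk e; have [_ _ _] := tens_balanced (d + e); rewrite /pmul_inner.
have [tl tr tb] := tens_balanced (d + e); split.
- by move=> k1 k2 s' h1 h2; rewrite mulrDr tl // cgradeM.
- by move=> k1 s1 s2 h1; rewrite mulrDr tr // cgradeM.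
- by move=> k1 r s1 h1; rewrite mulrA tb ?cgradeM // mulrCA.
Qed.

Lemma pmul_outer_balanced y : balanced (fun d k s => lift (pmul_inner d k s) y).
Proof.
move=> d; split.
- move=> k k' s hk hk'; have bs := pmul_inner_balanced s (cgradeD hk hk').
  have b1 := pmul_inner_balanced s hk; have b2 := pmul_inner_balanced s hk'.
  elim/tens_ind: y => [|x y ihx ihy|e k1 s1 h1].
  + by rewrite !lift0 // addr0.
  + by rewrite !liftD // ihx ihy addrACA.
  + rewrite !lift_tens // /pmul_inner mulrDl.
    by have [tl _ _] := tens_balanced (d + e); rewrite tl // cgradeM.
- move=> k s s' hk; have bs t := pmul_inner_balanced t hk.
  elim/tens_ind: y => [|x y ihx ihy|e k1 s1 h1].
  + by rewrite !lift0 // addr0.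
  + by rewrite !liftD // ihx ihy addrACA.
  + rewrite !lift_tens // /pmul_inner frobD mulrDl.
    by have [_ tr _] := tens_balanced (d + e); rewrite tr // cgradeM.
- move=> k r s hk; have bs := pmul_inner_balanced s (cgradeMr r hk).
  have b2 t := pmul_inner_balanced t hk.
  elim/tens_ind: y => [|x y ihx ihy|e k1 s1 h1].
  + by rewrite !lift0.
  + by rewrite !liftD // ihx ihy.
  + rewrite !lift_tens // /pmul_inner -mulrA (cscal_comm r h1) mulrA.
    have [_ _ tb] := tens_balanced (d + e); rewrite tb ?cgradeM //.
    by rewrite exprMn rmorphXn mulrA.
Qed.

Lemma pmulDl : left_distributive pmul +%R.
Proof. by move=> x y z; rewrite /pmul liftD //; apply: pmul_outer_balanced. Qed.

Lemma pmul0l y : pmul 0 y = 0.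
Proof. by rewrite /pmul lift0 //; apply: pmul_outer_balanced. Qed.

Lemma pmul_tensl d k s y : k \in cgrade C d ->
  pmul (tens d k s) y = lift (pmul_inner d k s) y.
Proof. by move=> hk; rewrite /pmul lift_tens //; apply: pmul_outer_balanced. Qed.

Lemma pmulDr : right_distributive pmul +%R.
Proof.
move=> x y z; elim/tens_ind: x => [|x x' ih ih'|d k s hk].
- by rewrite !pmul0l addr0.
- by rewrite !pmulDl ih ih' addrACA.
- by rewrite !pmul_tensl // liftD //; apply: pmul_inner_balanced.
Qed.

Lemma pmul0r x : pmul x 0 = 0.
Proof. by apply: (addrI (pmul x 0)); rewrite -pmulDr !addr0. Qed.

(* [(k (x) s) (k' (x) s') = k k' (x) s^(p^e) s'] for [k'] of degree [e].      *)
Lemma pmul_tens d k s e k' s' : k \in cgrade C d -> k' \in cgrade C e ->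
  pmul (tens d k s) (tens e k' s') =
  tens (d + e) (k * k') (s ^+ (p ^ e) * s').
Proof.
by move=> hk hk'; rewrite pmul_tensl // lift_tens //; apply: pmul_inner_balanced.
Qed.

Lemma pmulA : associative pmul.
Proof.
move=> x y z; elim/tens_ind: x => [|x x' ih ih'|d k s hk].
- by rewrite !pmul0l.
- by rewrite !pmulDl ih ih'.
elim/tens_ind: y => [|y y' ih ih'|e k' s' hk'].
- by rewrite !(pmul0l, pmul0r).
- by rewrite !(pmulDl, pmulDr) ih ih'.
elim/tens_ind: z => [|z z' ih ih'|e' k'' s'' hk''].
- by rewrite !pmul0r.
- by rewrite !pmulDr ih ih'.
rewrite !pmul_tens ?cgradeM // addnA mulrA; congr tens.
by rewrite exprMn -exprM -expnD mulrA.
Qed.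

Lemma cgrade1 : 1 \in cgrade C 0.
Proof. by rewrite -(rmorph1 (cscal C)) cscal_in0. Qed.

Definition pone : pullback := tens 0 1 1.

Lemma pmul1l : left_id pone pmul.
Proof.
move=> x; elim/tens_ind: x => [|x x' ih ih'|d k s hk].
- by rewrite pmul0r.
- by rewrite pmulDr ih ih'.
- by rewrite pmul_tens ?cgrade1 // add0n mul1r expr1n mul1r.
Qed.

Lemma pmul1r : right_id pone pmul.
Proof.
move=> x; elim/tens_ind: x => [|x x' ih ih'|d k s hk].
- by rewrite pmul0l.
- by rewrite pmulDl ih ih'.
- by rewrite pmul_tens ?cgrade1 // addn0 mulr1 expn0 expr1 mulr1.
Qed.

(* The group [pullback] with its ring structure, which needs [chS].           *)
Definition pullback_ring (_ : Fp_algebra p S) : Type := pullback.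

HB.instance Definition _ := GRing.Zmodule.on (pullback_ring chS).
HB.instance Definition _ := GRing.Zmodule_isPzRing.Build (pullback_ring chS)
  pmulA pmul1l pmul1r pmulDl pmulDr.

Definition pscal (s : S) : pullback_ring chS := tens 0 1 s.

Lemma pscal_is_zmod : zmod_morphism pscal.
Proof.
have [_ h _] := tens_balanced 0.
have hD s s' : pscal (s + s') = pscal s + pscal s' by apply: h; exact: cgrade1.
by move=> s s'; apply: (addIr (pscal s')); rewrite -hD !addrNK.
Qed.

Lemma pscal_is_monoid : monoid_morphism pscal.
Proof.
split=> // s s'; rewrite /pscal -[RHS]/(pmul _ _) pmul_tens ?cgrade1 //.
by rewrite mulr1 expn0 expr1.
Qed.

HB.instance Definition _ :=
  GRing.isZmodMorphism.Build S (pullback_ring chS) pscal pscal_is_zmod.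
HB.instance Definition _ :=
  GRing.isMonoidMorphism.Build S (pullback_ring chS) pscal pscal_is_monoid.

Lemma pgradeP e (x : pullback) :
  reflect (exists (n : nat) (k : 'I_n -> C) (s : 'I_n -> S),
     (forall i, k i \in cgrade C e) /\ x = \sum_i tens e (k i) (s i))
  (x \in pgrade e).
Proof. exact: asboolP. Qed.

Lemma pgrade_tens e k s : k \in cgrade C e -> tens e k s \in pgrade e.
Proof.
move=> hk; apply/pgradeP; exists 1%N, (fun=> k), (fun=> s); split=> //.
by rewrite big_ord1.
Qed.

Lemma pgrade0 e : 0 \in pgrade e.
Proof.
by apply/pgradeP; exists 0%N, (fun=> 0), (fun=> 0); split; [case|rewrite big_ord0].
Qed.

Lemma pgradeD e x y : x \in pgrade e -> y \in pgrade e -> x + y \in pgrade e.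
Proof.
move=> /pgradeP[n [k [s [hk ->]]]] /pgradeP[m [k' [s' [hk' ->]]]].
apply/pgradeP; exists (n + m)%N,
  (fun i : 'I_(n + m) => match fintype.split i with inl j => k j | inr j => k' j end),
  (fun i : 'I_(n + m) => match fintype.split i with inl j => s j | inr j => s' j end); split.
  by move=> i; case: fintype.split.
rewrite big_split_ord /=; congr (_ + _); apply: eq_bigr => i _.
  by rewrite (unsplitK (inl i)).
by rewrite (unsplitK (inr i)).
Qed.

Lemma pgrade_sum e (I : Type) (l : seq I) (P : pred I) (F : I -> pullback) :
  (forall i, P i -> F i \in pgrade e) -> \sum_(i <- l | P i) F i \in pgrade e.
Proof.
move=> h; apply: (big_ind (fun x => x \in pgrade e)) => //.
- exact: pgrade0.
- by move=> x y; exact: pgradeD.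
Qed.

Lemma pgrade_ind e (P : pullback -> Prop) :
  P 0 -> (forall x y, P x -> P y -> P (x + y)) ->
  (forall k s, k \in cgrade C e -> P (tens e k s)) ->
  forall x, x \in pgrade e -> P x.
Proof.
move=> P0 PD Pt x /pgradeP[n [k [s [hk ->]]]].
by apply: (big_ind P) => // i _; apply: Pt.
Qed.

Lemma tensN e k s : k \in cgrade C e -> - tens e k s = tens e (- k) s.
Proof.
move=> hk; have [h _ _] := tens_balanced e.
apply: (addIr (tens e k s)); rewrite addNr -h ?cgradeN // addNr.
apply: (addIr (tens e 0 s)).
by rewrite -h ?cgrade0 // !addr0 add0r.
Qed.

Lemma pgrade_zmod e : zmod_closed (pgrade e).
Proof.
split=> [|x y hx hy]; first exact: pgrade0.
apply: pgradeD => //; elim/pgrade_ind: y / hy => [|y z hy hz|k s hk].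
- by rewrite oppr0 pgrade0.
- by rewrite opprD pgradeD.
- by rewrite tensN // pgrade_tens // cgradeN.
Qed.

Definition pcomp_fun (e e' : nat) (k : C) (s : S) : pullback :=
  if e' == e then tens e' k s else 0.

Definition pcomp (e : nat) : pullback -> pullback := lift (pcomp_fun e).

Lemma pcomp_balanced e : balanced (pcomp_fun e).
Proof.
move=> e'; rewrite /pcomp_fun; case: eqP => _; first exact: tens_balanced.
by split=> *; rewrite ?addr0.
Qed.

Lemma pcompD e x y : pcomp e (x + y) = pcomp e x + pcomp e y.
Proof. by apply: liftD; exact: pcomp_balanced. Qed.

Lemma pcomp0 e : pcomp e 0 = 0.
Proof. by apply: lift0; exact: pcomp_balanced. Qed.

Lemma pcomp_tens e e' k s : k \in cgrade C e' ->
  pcomp e (tens e' k s) = if e' == e then tens e' k s else 0.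
Proof. by move=> hk; apply: lift_tens => //; exact: pcomp_balanced. Qed.

Lemma pcomp_grade e e' x : x \in pgrade e' ->
  pcomp e x = if e' == e then x else 0.
Proof.
move=> hx; elim/pgrade_ind: x / hx => [|x y hx hy|k s hk].
- by rewrite pcomp0 if_same.
- by rewrite pcompD hx hy; case: ifP => _ //; rewrite addr0.
- by rewrite pcomp_tens.
Qed.

Lemma pcomp_in e x : pcomp e x \in pgrade e.
Proof.
elim/tens_ind: x => [|x y hx hy|d k s hk].
- by rewrite pcomp0 pgrade0.
- by rewrite pcompD pgradeD.
- by rewrite pcomp_tens //; case: eqP => [<-|_]; rewrite ?pgrade_tens ?pgrade0.
Qed.

Lemma pgrade_gen x : exists (n : nat) (c : nat -> pullback),
  (forall e, c e \in pgrade e) /\ x = \sum_(0 <= e < n) c e.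
Proof.
suff [n hn] : exists n, forall m, (n <= m)%N ->
    x = \sum_(0 <= e < m) pcomp e x.
  by exists n, (pcomp^~ x); split; [move=> e; exact: pcomp_in | exact: hn].
elim/tens_ind: x => [|x y [n hn] [n' hn']|d k s hk].
- by exists 0%N => m _; rewrite big1 // => e _; rewrite pcomp0.
- exists (maxn n n') => m; rewrite geq_max => /andP[le le'].
  under eq_bigr do rewrite pcompD.
  by rewrite big_split -hn -?hn'.
- exists d.+1 => m lt; under eq_bigr do rewrite pcomp_tens //.
  rewrite -big_mkcond /= (eq_bigl (fun i => i == d)); last by move=> i; rewrite eq_sym.
  by rewrite big_nat1_eq leq0n /= ?lt.
Qed.

Lemma pgrade_direct (n : nat) (c : nat -> pullback) :
  (forall e, c e \in pgrade e) -> \sum_(0 <= e < n) c e = 0 ->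
  forall e, (e < n)%N -> c e = 0.
Proof.
move=> hc h0 e lt; rewrite -(pcomp0 e) -h0.
rewrite (big_morph (pcomp e) (pcompD e) (pcomp0 e)).
under eq_bigr do rewrite (pcomp_grade _ (hc _)).
rewrite -big_mkcond /= (eq_bigl (fun i => i == e)) //.
by rewrite big_nat1_eq leq0n /= ?lt.
Qed.

Lemma pgradeM d e (x y : pullback_ring chS) :
  x \in pgrade d -> y \in pgrade e -> x * y \in pgrade (d + e)%N.
Proof.
move=> hx hy; elim/pgrade_ind: x / hx => [|x x' hx hx'|k s hk].
- by rewrite mul0r pgrade0.
- by rewrite mulrDl pgradeD.
elim/pgrade_ind: y / hy => [|y y' hy hy'|k' s' hk'].
- by rewrite mulr0 pgrade0.
- by rewrite mulrDr pgradeD.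
- rewrite -[_ * _]/(pmul _ _) pmul_tens //.
  by rewrite pgrade_tens // cgradeM.
Qed.

Lemma pscal_comm e s (x : pullback_ring chS) : x \in pgrade e ->
  pscal s * x = x * pscal (s ^+ (p ^ e)).
Proof.
move=> hx; elim/pgrade_ind: x / hx => [|x x' hx hx'|k s' hk].
- by rewrite mul0r mulr0.
- by rewrite mulrDl mulrDr hx hx'.
- rewrite -[LHS]/(pmul _ _) -[RHS]/(pmul _ _) !pmul_tens ?cgrade1 //.
  by rewrite add0n addn0 mul1r mulr1 expn0 expr1 mulrC.
Qed.

Lemma pscal_grade0 (x : pullback_ring chS) :
  x \in pgrade 0 <-> exists s, x = pscal s.
Proof.
split=> [hx|[s ->]]; last exact/pgrade_tens/cgrade1.
elim/pgrade_ind: x / hx => [|x x' [s hs] [s' hs']|k s hk].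
- by exists 0; rewrite raddf0.
- by exists (s + s'); rewrite hs hs' raddfD.
- have /cscal_grade0[r ->] := hk; exists (f r * s).
  have [_ _ h] := tens_balanced 0; rewrite /pscal -h ?cgrade1 //.
  by rewrite mul1r.
Qed.

Definition unscal (k : C) : R := xget 0 [set r | k = cscal C r]%classic.

Lemma unscalK r : unscal (cscal C r) = r.
Proof.
by rewrite /unscal; case: xgetP => [r' _ /cscal_inj|/(_ r)] //; case.
Qed.

Definition deg0_fun (e : nat) (k : C) (s : S) : S :=
  if e == 0%N then f (unscal k) * s else 0.

Lemma deg0_balanced : balanced deg0_fun.
Proof.
case=> [|e]; rewrite /deg0_fun /=; last by split=> *; rewrite ?addr0.
split.
- move=> k k' s /cscal_grade0[r ->] /cscal_grade0[r' ->].
  by rewrite -rmorphD !unscalK rmorphD mulrDl.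
- by move=> k s s' _; rewrite mulrDr.
- move=> k r s /cscal_grade0[r' ->]; rewrite -rmorphM !unscalK rmorphM.
  by rewrite mulrA.
Qed.

Lemma pscal_inj : injective pscal.
Proof.
move=> s s' /(congr1 (lift deg0_fun)).
rewrite !lift_tens ?cgrade1 //; try exact: deg0_balanced.
by rewrite /deg0_fun /= -(rmorph1 (cscal C)) unscalK rmorph1 !mul1r.
Qed.

(* [f^* C]                                                                    *)
Definition pullback_alg : cartierAlgebra p S :=
  @CartierAlgebra p S (pullback_ring chS) pgrade pscal pgrade_zmod pgrade_gen
    pgrade_direct pgradeM pscal_inj pscal_grade0 pscal_comm.

Section UpperShriek.
Variable M : lmodType C.

Definition Rlinear : {pred S -> M} :=
  [pred h | `[< (forall s t, h (s + t) = h s + h t) /\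
                (forall r s, h (f r * s) = cscal C r *: h s) >]].

Lemma RlinearP (h : S -> M) :
  reflect ((forall s t, h (s + t) = h s + h t) /\
           (forall r s, h (f r * s) = cscal C r *: h s)) (h \in Rlinear).
Proof. exact: asboolP. Qed.

Lemma Rlinear_zmod : zmod_closed Rlinear.
Proof.
split=> [|g h /RlinearP[ga gl] /RlinearP[ha hl]]; apply/RlinearP; split.
- by move=> s t; rewrite /= addr0.
- by move=> r s; rewrite /= scaler0.
- by move=> s t; rewrite !fctE ga ha opprD addrACA.
- by move=> r s; rewrite !fctE gl hl scalerBr.
Qed.

(* [f^! M = Hom_R(S, M)], a left [f^* C]-module.                              *)
Record upper_shriek (h : Fp_algebra p S) : Type := UpperShriek {
  us_fun :> S -> M;
  us_lin : us_fun \in Rlinear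
}.

HB.instance Definition _ := [isSub for @us_fun chS].
HB.instance Definition _ := [Choice of upper_shriek chS by <:].
HB.instance Definition _ := GRing.isZmodClosed.Build (S -> M) Rlinear Rlinear_zmod.
HB.instance Definition _ := [SubChoice_isSubZmodule of upper_shriek chS by <:].

Lemma us_ext (mu nu : upper_shriek chS) : (forall t, mu t = nu t) -> mu = nu.
Proof. by move=> h; apply: val_inj; apply/funext. Qed.

Lemma us_add (mu : upper_shriek chS) s t : mu (s + t) = mu s + mu t.
Proof. by have /RlinearP[h _] := us_lin mu; exact: h. Qed.

Lemma us_scale (mu : upper_shriek chS) r s : mu (f r * s) = cscal C r *: mu s.
Proof. by have /RlinearP[_ h] := us_lin mu; exact: h. Qed.

Lemma usD (mu nu : upper_shriek chS) t : (mu + nu) t = mu t + nu t.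
Proof. by []. Qed.

(* [((k (x) s) . mu) (t) = k . mu (s t^(p^e))].                               *)
Definition us_act_fun (mu : upper_shriek chS) (t : S) (e : nat) (k : C) (s : S)
  : M := k *: mu (s * t ^+ (p ^ e)).

Lemma us_act_balanced mu t : balanced (us_act_fun mu t).
Proof.
move=> e; rewrite /us_act_fun; split.
- by move=> k k' s _ _; rewrite scalerDl.
- by move=> k s s' _; rewrite mulrDl us_add scalerDr.
- by move=> k r s _; rewrite -mulrA us_scale scalerA.
Qed.

Lemma us_act_lin (x : pullback) mu :
  (fun t => lift (us_act_fun mu t) x) \in Rlinear.
Proof.
have bal := us_act_balanced mu.
apply/RlinearP; split=> [s t|r t].
- elim/tens_ind: x => [|x y hx hy|e k u hk].
  + by rewrite !lift0 // addr0.
  + by rewrite !liftD // hx hy addrACA.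
  + by rewrite !lift_tens // /us_act_fun frobD mulrDr us_add scalerDr.
- elim/tens_ind: x => [|x y hx hy|e k u hk].
  + by rewrite !lift0 // scaler0.
  + by rewrite !liftD // hx hy scalerDr.
  + rewrite !lift_tens // /us_act_fun exprMn mulrCA -rmorphXn us_scale.
    by rewrite !scalerA (cscal_comm r hk).
Qed.

Definition us_act (x : pullback_alg) (mu : upper_shriek chS) : upper_shriek chS :=
  UpperShriek chS (us_act_lin x mu).

Lemma us_act_tens e k s mu t : k \in cgrade C e ->
  us_act (tens e k s) mu t = k *: mu (s * t ^+ (p ^ e)).
Proof. by move=> hk; apply: lift_tens => //; exact: us_act_balanced. Qed.

Lemma us_actDl mu : {morph us_act^~ mu : x y / x + y}.
Proof.
by move=> x y; apply: us_ext => t; apply: liftD; exact: us_act_balanced.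
Qed.

Lemma us_actDr : right_distributive us_act +%R.
Proof.
move=> x mu nu; apply: us_ext => t; rewrite usD /=.
have bal m := us_act_balanced m t.
elim/tens_ind: x => [|x y hx hy|e k s hk].
- by rewrite !lift0 // addr0.
- by rewrite !liftD // hx hy addrACA.
- by rewrite !lift_tens // /us_act_fun usD scalerDr.
Qed.

Lemma us_act0l mu : us_act 0 mu = 0.
Proof. by apply: (addrI (us_act 0 mu)); rewrite -us_actDl !addr0. Qed.

Lemma us_act0r x : us_act x 0 = 0.
Proof. by apply: (addrI (us_act x 0)); rewrite -us_actDr !addr0. Qed.

Lemma us_act1 : left_id 1 us_act.
Proof.
move=> mu; apply: us_ext => t; rewrite us_act_tens ?cgrade1 //.
by rewrite scale1r mul1r expn0 expr1.
Qed.

Lemma us_actA x y mu : us_act x (us_act y mu) = us_act (x * y) mu.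
Proof.
elim/tens_ind: x => [|x x' hx hx'|d k s hk].
- by rewrite mul0r !us_act0l.
- by rewrite mulrDl !us_actDl hx hx'.
elim/tens_ind: y => [|y y' hy hy'|e k' s' hk'].
- by rewrite mulr0 us_act0l us_act0r.
- by rewrite mulrDr !us_actDl us_actDr hy hy'.
apply: us_ext => t; rewrite -[_ * _]/(pmul _ _) pmul_tens //.
rewrite !us_act_tens ?cgradeM // scalerA exprMn -exprM -expnD addnC.
by congr (_ *: mu _); rewrite mulrA [s' * _]mulrC.
Qed.

HB.instance Definition _ := GRing.Zmodule_isLmodule.Build pullback_alg
  (upper_shriek chS) us_actA us_act1 us_actDr us_actDl.

Definition Tr (mu : upper_shriek chS) : M := mu 1.

End UpperShriek.
End Pullback.

Arguments pullback_alg {p R S} f C chS.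
Arguments upper_shriek {p R S} f {C} M h.
Arguments Tr {p R S f C chS M} mu.

(* Main.v *)
(* An element of [C_+^e M] lifts through a surjective trace to an element of  *)
(* [(f^*C)_+^e f^!M], but the lift depends on [e]: equality needs the chain   *)
(* [N_e = (f^*C)_+^e f^!M] to stabilize. The ideals [J_e = (N_(e+1) : N_e)]   *)
(* increase, hence reach a value [J]. As [a k = k a^q] with [q >= 2], the     *)
(* square of [J] maps some [N_e0] into every [N_e]. If [J] were proper, take  *)
(* [P] minimal among finitely many primes over [J] with product inside [J]:   *)
(* at [P] the quotient of [N_e0] by the intersection of the [N_e] has finite  *)
(* length, so [t N_e] lies in [N_(e+1)] for some [t] outside [P], although    *)
(* [t] belongs to [J], which [P] contains.                                    *)

Require Import Defs.
From HB Require Import structures.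
From mathcomp Require Import all_boot all_order all_algebra.
From mathcomp Require Import boolp classical_sets functions.
Set Implicit Arguments.
Unset Strict Implicit.
Unset Printing Implicit Defensive.
Import GRing.Theory.
Local Open Scope classical_set_scope.
Local Open Scope ring_scope.

(** Inclusion: since [(k (x) s) mu] has the value [k mu(s t^q)] at [t], every value of an element of
    [(f^*C)_+^e f^!M] lies in [C_+^e M] ([cimage_us]). Equality: if the trace is onto, the identity
    [k Tr(mu) = Tr((k (x) 1) mu)] lifts [C_+^e M] one exponent at a time ([cimage_Tr_surj]). A
    single lift suffices when its exponent is past the point where the chain on [f^!M] becomes
    constant. That point exists by [cimage_stable] over [S], because [f^!M] is finitely generated
    ([us_fin_gen]).

    Stabilization has two halves. The relation [a k = k a^q] gives two properties of the ideals
    [J_e]; [chain_stable] is then commutative algebra on a chain of submodules with these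
    properties. Multipliers [t] outside a prime [P] replace localization, and adjoining generators
    one by one replaces length. *)

(** * Submodules and finite spans *)

Section Submodules.
Variables (R : comPzRingType) (M : lmodType R).

Definition submodule (L : set M) : Prop :=
  [/\ L 0, forall x y, L x -> L y -> L (x + y) & forall r x, L x -> L (r *: x)].

Definition adjoin (L : set M) (x : M) : set M :=
  [set m | exists r y, L y /\ m = r *: x + y].

(** Generators enter one at a time, which is the form needed to climb from [L] by steps of length at
    most one. *)
Definition extend (L : set M) (g : seq M) : set M :=
  foldr (fun x K => adjoin K x) L g.

Definition span (g : seq M) : set M := extend [set 0] g.

Lemma submoduleB L x y : submodule L -> L x -> L y -> L (x - y).
Proof. by case=> _ LD LZ Lx Ly; apply: LD => //; rewrite -scaleN1r; apply: LZ. Qed.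

Lemma submodule_sum L (I : Type) (l : seq I) (P : pred I) (F : I -> M) :
  submodule L -> (forall i, P i -> L (F i)) -> L (\sum_(i <- l | P i) F i).
Proof. by case=> L0 LD _ LF; apply: big_ind. Qed.

Lemma submodule0 : submodule [set 0].
Proof. by split=> [//|_ _ -> ->|r _ ->] /=; rewrite ?addr0 ?scaler0. Qed.

Lemma submodule_adjoin L x : submodule L -> submodule (adjoin L x).
Proof.
move=> [L0 LD LZ]; split.
- by exists 0, 0; rewrite scale0r addr0.
- move=> _ _ [r [y [Ly ->]]] [s [z [Lz ->]]]; exists (r + s), (y + z).
  by split; [exact: LD | rewrite scalerDl addrACA].
- move=> a _ [r [y [Ly ->]]]; exists (a * r), (a *: y).
  by split; [exact: LZ | rewrite scalerDr scalerA].
Qed.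

Lemma sub_adjoin L x : L `<=` adjoin L x.
Proof. by move=> y Ly; exists 0, y; rewrite scale0r add0r. Qed.

Lemma mem_adjoin L x : submodule L -> adjoin L x x.
Proof. by case=> L0 _ _; exists 1, 0; rewrite scale1r addr0. Qed.

Lemma submodule_extend L g : submodule L -> submodule (extend L g).
Proof. by move=> sL; elim: g => //= x g; apply: submodule_adjoin. Qed.

Lemma submodule_span g : submodule (span g).
Proof. exact/submodule_extend/submodule0. Qed.

Lemma sub_extend L g : L `<=` extend L g.
Proof. by elim: g => //= x g Lg; apply: subset_trans Lg (@sub_adjoin _ _). Qed.

Lemma mem_extend L g x : submodule L -> x \in g -> extend L g x.
Proof.
move=> sL; elim: g => //= y g ih; rewrite inE => /predU1P[->|/ih gx].
  exact/mem_adjoin/submodule_extend.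
exact: sub_adjoin.
Qed.

Lemma mem_span g x : x \in g -> span g x.
Proof. exact/mem_extend/submodule0. Qed.

Lemma span_sub L g : submodule L -> (forall x, x \in g -> L x) -> span g `<=` L.
Proof.
case=> L0 LD LZ; elim: g => [|x g ih] gL /=; first by move=> _ ->.
move=> _ [r [y [gy ->]]]; apply: LD; first by apply/LZ/gL; rewrite mem_head.
by apply: ih gy => z gz; apply: gL; rewrite inE gz orbT.
Qed.

Lemma span_sum g x : span g x ->
  exists a : nat -> R, x = \sum_(i < size g) a i *: g`_i.
Proof.
elim: g x => [_ ->|y g ih x [r [z [/ih[a ->] ->]]]].
  by exists (fun=> 0); rewrite big_ord0.
by exists (fun i => if i is j.+1 then a j else r); rewrite big_ord_recl.
Qed.

End Submodules.

(** * Noetherian rings: chains of ideals, products of primes, submodules *)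

Section Noetherian.
Variable R : comPzRingType.
Hypothesis noethR : noetherian R.

Lemma noetherian_gen (I : set R) : ideal I -> exists (n : nat) (g : 'I_n -> R),
  (forall i, I (g i)) /\ forall x, I x -> exists a : 'I_n -> R, x = \sum_i a i * g i.
Proof.
move=> /noethR[n [g ->]]; exists n, g; split=> // i.
exists (fun j => (j == i)%:R); rewrite (bigD1 i) //= eqxx mul1r big1 ?addr0 //.
by move=> j /negPf->; rewrite mul0r.
Qed.

Lemma ideal_sum (I : set R) n (a g : 'I_n -> R) :
  ideal I -> (forall i, I (g i)) -> I (\sum_i a i * g i).
Proof. by case=> I0 ID IM Ig; apply: big_ind => // i _; apply: IM. Qed.

Lemma noetherian_acc (J : nat -> set R) : (forall e, ideal (J e)) ->
  (forall e, J e `<=` J e.+1) ->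
  exists e0, forall e, (e0 <= e)%N -> J e `<=` J e0.
Proof.
move=> idJ J1.
have homoJ d e : (d <= e)%N -> J d `<=` J e.
  by move/subnK <-; elim: (e - d)%N => // k ih x /ih; apply: J1.
have idU : ideal [set x | exists e, J e x].
  split.
  - by exists 0%N; have [] := idJ 0%N.
  - move=> x y [d Jx] [e Jy]; exists (maxn d e); have [_ JD _] := idJ (maxn d e).
    by apply: JD; [apply: homoJ Jx | apply: homoJ Jy]; rewrite ?leq_maxl ?leq_maxr.
  - by move=> a x [e Jx]; exists e; have [_ _ JM] := idJ e; apply: JM.
have [n [g [/choice[d Jg] gen]]] := noetherian_gen idU.
exists (\max_i d i)%N => e _ x Jx; have [|a ->] := gen x; first by exists e.
by apply: ideal_sum => // i; apply: homoJ (Jg i); apply: leq_bigmax.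
Qed.

Lemma noetherian_max (F : set (set R)) (I0 : set R) :
  F `<=` @ideal R -> F I0 ->
  exists2 I, F I & forall K, F K -> I `<=` K -> K `<=` I.
Proof.
move=> Fid FI0; apply: contrapT => nomax.
have step (I : {I | F I}) : exists K : {I | F I},
    sval I `<=` sval K /\ ~ (sval K `<=` sval I).
  apply: contrapT => no; apply: nomax; exists (sval I); first exact: svalP.
  move=> K FK IK; apply: contrapT => nKI; apply: no.
  by exists (exist _ K FK).
have [s sP] := choice step.
pose J n := sval (iter n s (exist _ I0 FI0)).
have [|n|e0] := @noetherian_acc J; first by move=> n; apply/Fid/svalP.
  by have [] := sP (iter n s (exist _ I0 FI0)).
move/(_ e0.+1 (leqnSn _)).
by have [_] := sP (iter e0 s (exist _ I0 FI0)).
Qed.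

(* Only the products of one element from each set of [l], not their span.     *)
Fixpoint iprod (l : seq (set R)) : set R :=
  if l is P :: l' then [set x | exists a b, [/\ P a, iprod l' b & x = a * b]]
  else [set 1].

Lemma iprod_cat l l' x : iprod (l ++ l') x ->
  exists a b, [/\ iprod l a, iprod l' b & x = a * b].
Proof.
elim: l x => [|P l ih] x /=; first by move=> lx; exists 1, x; rewrite mul1r.
move=> [a [b [Pa /ih[c [d [lc ld ->]] ->]]]]; exists (a * c), d.
by split; [exists a, c | | rewrite mulrA].
Qed.

(** A maximal counterexample [K] is proper and not prime, so it contains some [a b] with [a], [b]
    outside [K]. The lists for [K + (a)] and [K + (b)] concatenate to one for [K], as
    [(K + (a)) (K + (b))] lies in [K]. *)
Lemma noetherian_prime_prod (I : set R) : ideal I -> exists l,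
  (forall P, P \in l -> prime_ideal P /\ I `<=` P) /\ iprod l `<=` I.
Proof.
move=> idI; apply: contrapT => noI.
pose F := [set K : set R | ideal K /\ ~ exists l,
  (forall P, P \in l -> prime_ideal P /\ K `<=` P) /\ iprod l `<=` K].
have [||K [idK noK] maxK] := @noetherian_max F I; [by move=> ? []|by []|].
(* Ideals are the submodules of [R^o], so [adjoin] gives [K + (a)]. *)
have big a : ~ K a -> exists l,
    (forall P, P \in l -> prime_ideal P /\ K `<=` P) /\ iprod l `<=` @adjoin R R^o K a.
  move=> nKa; apply: contrapT => no.
  apply: nKa; apply: (maxK (@adjoin R R^o K a)); [|exact: (@sub_adjoin R R^o K a)|exact: (@mem_adjoin R R^o K a idK)].
  split; first exact: (@submodule_adjoin R R^o K a idK).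
  case=> l [lP lK]; apply: no; exists l; split=> // P /lP[pP KP]; split=> //.
  exact: subset_trans (@sub_adjoin R R^o K a) KP.
have [K0 KD KM] := idK.
apply: (noK); case: (pselect (K 1)) => K1.
  by exists [::]; split=> // _ ->.
case: (pselect (prime_ideal K)) => pK.
  exists [:: K]; split=> [P|_ [a [_ [Ka -> ->]]]]; last by rewrite mulr1.
  by rewrite inE => /eqP->; split.
have [a [b [nKa nKb Kab]]] : exists a b, [/\ ~ K a, ~ K b & K (a * b)].
  apply: contrapT => no; apply: pK; split=> // a b Kab.
  apply: contrapT => /not_orP[nKa nKb]; apply: no; by exists a, b.
have [l [lP lK]] := big a nKa; have [l' [lP' lK']] := big b nKb.
exists (l ++ l'); split=> [P|x /iprod_cat[c [d [/lK[r [y [Ky ->]]] /lK'[s [z [Kz ->]]] ->]]]].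
  by rewrite mem_cat => /orP[/lP|/lP'].
rewrite mulrDr mulrDl -addrA; apply: (KD).
  by rewrite mulrACA; apply: KM.
by apply: KD; [rewrite mulrC|]; apply: (KM).
Qed.

Lemma minimal_mem (T : Type) (l : seq (set T)) : l != [::] ->
  exists2 P, P \in l & forall Q, Q \in l -> Q `<=` P -> P `<=` Q.
Proof.
elim: l => // P l ih _; case: (eqVneq l [::]) => [->|/ih[Q lQ minQ]].
  by exists P; rewrite ?mem_head // => Q; rewrite inE => /eqP->.
case: (pselect (P `<=` Q)) => PQ.
  exists P; rewrite ?mem_head // => K; rewrite inE => /predU1P[->//|lK KP].
  by apply: (subset_trans PQ); apply: minQ => //; apply: subset_trans PQ.
by exists Q; rewrite ?inE ?lQ ?orbT // => K; rewrite inE => /predU1P[->//|/minQ].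
Qed.

(** Induction on [g]: the coefficients of [x] in elements of [L] form an ideal. Lifts [z i] of its
    generators, with generators of [L] intersected with [span g], generate [L]. *)
Lemma submodule_fg (M : lmodType R) (g : seq M) (L : set M) :
  submodule L -> L `<=` span g -> exists h, L = span h.
Proof.
elim: g L => [|x g ih] L sL Lg.
  by exists [::]; apply/seteqP; split=> // _ ->; case: sL.
have sg := submodule_span g; have [L0 LD LZ] := sL; have [g0 gD gZ] := sg.
have [||h' Lh'] := ih (L `&` span g); [|by move=> ? []|].
  split=> // [y z [Ly gy] [Lz gz]|r y [Ly gy]]; first by split; [apply: LD|apply: gD].
  by split; [apply: LZ|apply: gZ].
pose I := [set r : R | exists y, span g y /\ L (r *: x + y)].
have idI : ideal I.
  split.
  - by exists 0; rewrite scale0r addr0.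
  - move=> r s [y [gy Ly]] [z [gz Lz]]; exists (y + z); split; first exact: gD.
    by rewrite scalerDl addrACA; apply: LD.
  - move=> a r [y [gy Ly]]; exists (a *: y); split; first exact: gZ.
    by rewrite -scalerA -scalerDr; apply: LZ.
have [n [r [/choice[y yP] gen]]] := noetherian_gen idI.
pose z i := r i *: x + y i.
exists ([seq z i | i <- enum 'I_n] ++ h'); apply/seteqP; split; last first.
  apply: span_sub => // w; rewrite mem_cat => /orP[/mapP[i _ ->]|/mem_span].
    by have [] := yP i.
  by rewrite -Lh' => -[].
move=> w Lw; have [s [v [gv wE]]] := Lg w Lw.
have [|a sE] := gen s; first by exists v; rewrite -wE.
set H := _ ++ _; have sH := submodule_span H; have [_ HD HZ] := sH.
have zH i : span H (z i).
  by apply/mem_span; rewrite mem_cat map_f // mem_enum.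
pose u := \sum_i a i *: z i.
have Hu : span H u by apply: submodule_sum => // i _; apply: HZ.
(* [u] has the same coefficient of [x] as [w], so [w - u] falls into [span g]. *)
have -> : w = u + (w - u) by rewrite addrC subrK.
apply: HD => //.
have sub : span h' `<=` span H.
  by apply: span_sub => // t ht; apply: mem_span; rewrite mem_cat ht orbT.
apply: sub; rewrite -Lh'; split.
  apply: submoduleB => //; apply: submodule_sum => // i _; apply: LZ.
  by have [] := yP i.
rewrite wE sE /u.
under [X in _ - X]eq_bigr do rewrite scalerDr scalerA.
rewrite big_split /= -scaler_suml opprD addrACA subrr add0r.
by apply: submoduleB => //; apply: submodule_sum => // i _; apply: gZ; case: (yP i).
Qed.

End Noetherian.

(** * Stabilization of a decreasing chain of submodules *)

Section Chain.
Variables (R : comPzRingType) (M : lmodType R).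
Hypothesis noethR : noetherian R.
Variable g : seq M.
Hypothesis gen_g : forall m, span g m.
Variable N : nat -> set M.
Hypothesis N_submodule : forall e, submodule (N e).
Hypothesis N_decr : forall e, N e.+1 `<=` N e.

Lemma N_decr_le d e : (d <= e)%N -> N e `<=` N d.
Proof. by move/subnK <-; elim: (e - d)%N => // k ih x /N_decr; apply: ih. Qed.

(* Up to localization at [P], the sets [N e `&` L] are eventually constant.   *)
Definition locally_stable (P : set R) (L : set M) : Prop :=
  exists e0, forall e, (e0 <= e)%N -> exists t, ~ P t /\
    forall z, N e z -> L z -> N e.+1 (t *: z).

Lemma locally_stable_sub P (K L : set M) :
  K `<=` L -> locally_stable P L -> locally_stable P K.
Proof.
move=> KL [e0 h]; exists e0 => e /h[t [Pt tN]]; exists t; split=> // z Nz /KL.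
exact: tN.
Qed.

(* [x] spans a vector space of dimension at most one over the residue field   *)
(* of [P] modulo [L], so the image of [N e] in it can drop only once.         *)
Lemma locally_stable_adjoin P L x : prime_ideal P -> submodule L ->
  (forall a, P a -> L (a *: x)) -> locally_stable P L ->
  locally_stable P (adjoin L x).
Proof.
move=> [_ P1 PM] sL PxL [e0 h]; have [L0 LD LZ] := sL.
case: (pselect (forall e, exists t y, [/\ ~ P t, L y & N e (t *: x + y)])) => [B|].
  exists e0 => e /h[t1 [Pt1 tN]]; have [t [y [Pt Ly Ny]]] := B e.+1.
  exists (t1 * t); split=> [/PM[]//|_ /[swap] [[r [y1 [Ly1 ->]]]] Nz].
  set z := r *: x + y1 in Nz *; have [_ ND NZ] := N_submodule e.+1.
  have [_ _ NZ'] := N_submodule e.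
  (* The multiples of [x] cancel in the difference, which therefore lies in [L] and in [N e], where
     [t1] applies. *)
  have -> : (t1 * t) *: z = t1 *: (t *: z - r *: (t *: x + y))
                            + (t1 * r) *: (t *: x + y).
    by rewrite scalerBr !scalerA subrK.
  apply: (ND); last exact: NZ.
  apply: tN.
    apply: submoduleB => //; first exact: NZ'.
    by apply/N_decr/NZ.
  rewrite /z !scalerDr !scalerA [r * t]mulrC opprD addrACA subrr add0r.
  by apply: submoduleB => //; apply: LZ.
(* From [e1] on, the coefficient of [x] in any element of [N e] lies in [P], so that element is
   already in [L]. *)
move=> /existsNP[e1 B]; exists (maxn e0 e1) => e; rewrite geq_max => /andP[le0 le1].
have [t [Pt tN]] := h e le0; exists t; split=> // z Nz [r [y [Ly zE]]].
apply: tN => //; rewrite zE; apply: LD => //; apply: PxL.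
apply: contrapT => Pr; apply: B; exists r, y; split=> //.
by rewrite -zE; apply: N_decr_le Nz.
Qed.

Lemma locally_stable_extend P L h : prime_ideal P -> submodule L ->
  (forall a x, P a -> x \in h -> L (a *: x)) -> locally_stable P L ->
  locally_stable P (extend L h).
Proof.
move=> pP sL; elim: h => //= x h ih PL stL.
apply: locally_stable_adjoin => //; first exact: submodule_extend.
  by move=> a Pa; apply/sub_extend/PL; rewrite ?mem_head.
by apply: ih => // a y Pa hy; apply: PL; rewrite ?inE ?hy ?orbT.
Qed.

Definition colon (L : set M) (A : set R) : set M :=
  [set m | forall a, A a -> L (a *: m)].

Lemma submodule_colon L A : submodule L -> submodule (colon L A).
Proof.
move=> [L0 LD LZ]; split.
- by move=> a _; rewrite scaler0.
- by move=> x y Lx Ly a Aa; rewrite scalerDr; apply: LD; [apply: Lx|apply: Ly].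
- by move=> r x Lx a Aa; rewrite scalerA mulrC -scalerA; apply/LZ/Lx.
Qed.

(** If [Q] is not inside [P], some [s] in [Q] outside [P] carries [colon L Q] into [L]. Otherwise
    [P] lies in [Q], so [P] carries the finitely many generators of [colon L Q] into [L], and they
    can be adjoined. *)
Lemma locally_stable_colon P L Q : prime_ideal P -> submodule L ->
  (Q `<=` P -> P `<=` Q) -> locally_stable P L -> locally_stable P (colon L Q).
Proof.
move=> pP sL minP stL; case: (pselect (Q `<=` P)) => [/minP PQ|].
  have [h hE] := submodule_fg noethR (submodule_colon Q sL) (fun m _ => gen_g m).
  apply: (@locally_stable_sub _ _ (extend L h)).
    rewrite hE; apply: span_sub; first exact: submodule_extend.
    by move=> x; apply: mem_extend.
  apply: locally_stable_extend => // a x /PQ Qa /mem_span; rewrite -hE.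
  exact.
move=> /existsNP[s /not_implyP[Qs Ps]]; have [e0 h] := stL.
exists e0 => e /h[t [Pt tN]]; exists (t * s); split.
  by have [_ _ PM] := pP; case/PM.
move=> z Nz Lz; rewrite -scalerA; apply: tN; last exact: Lz.
by have [_ _ NZ] := N_submodule e; apply: NZ.
Qed.

Lemma locally_stable_colon_prod P L l : prime_ideal P -> submodule L ->
  (forall Q, Q \in l -> Q `<=` P -> P `<=` Q) -> locally_stable P L ->
  locally_stable P (colon L (iprod l)).
Proof.
move=> pP sL; elim: l => [|Q l ih] minP stL.
  by apply: locally_stable_sub stL => m /(_ 1 erefl); rewrite scale1r.
apply: (@locally_stable_sub _ _ (colon (colon L (iprod l)) Q)).
  move=> m Lm a Qa b lb; rewrite scalerA mulrC; apply: Lm.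
  by exists a, b.
apply: locally_stable_colon => //; first exact: submodule_colon.
  by apply: minP; rewrite mem_head.
by apply: ih => // K lK; apply: minP; rewrite inE lK orbT.
Qed.

Definition step_ideal (e : nat) : set R :=
  [set a | forall m, N e m -> N e.+1 (a *: m)].

(** These two hypotheses are all that the chain argument retains of the Cartier structure. *)
Hypothesis step_ideal_incr : forall e, step_ideal e `<=` step_ideal e.+1.
Hypothesis step_idealM : forall d e a b m, step_ideal d a -> step_ideal d b ->
  N d m -> N e (a *: (b *: m)).

Lemma ideal_step e : ideal (step_ideal e).
Proof.
have [N0 ND NZ] := N_submodule e.+1; split.
- by move=> m _; rewrite scale0r.
- by move=> a b Ja Jb m Nm; rewrite scalerDl; apply: ND; [apply: Ja|apply: Jb].
- by move=> a b Jb m Nm; rewrite -scalerA; apply/NZ/Jb.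
Qed.

Theorem chain_stable : exists e0, forall e, (e0 <= e)%N -> N e = N e0.
Proof.
have [e0 acc] := noetherian_acc noethR ideal_step step_ideal_incr.
exists e0; have incr d e : (d <= e)%N -> step_ideal d `<=` step_ideal e.
  by move/subnK <-; elim: (e - d)%N => // k ih x /ih; apply: step_ideal_incr.
(* [1] in [J_e] means [N e] is contained in [N e.+1]. *)
suff J1 : step_ideal e0 1.
  move=> e /subnK <-; elim: (e - e0)%N => // k <-.
  apply/seteqP; split=> [|m Nm]; first exact: N_decr.
  by have := incr e0 (k + e0)%N (leq_addl _ _) _ J1 m Nm; rewrite scale1r.
apply: contrapT => J1.
have [l [lP lJ]] := noetherian_prime_prod noethR (ideal_step e0).
have [|P lPl minP] := @minimal_mem _ l.
  by apply/eqP => l0; apply/J1/lJ; rewrite l0.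
have [pP JP] := lP P lPl.
pose L := [set m | forall e, N e m].
have sL : submodule L.
  split=> [e|x y Lx Ly e|r x Lx e]; have [N0 ND NZ] := N_submodule e => //.
    by apply: ND; [apply: Lx|apply: Ly].
  exact/NZ/Lx.
have stL : locally_stable P L.
  exists 0%N => e _; exists 1; split; first by case: pP.
  by move=> z _ Lz; rewrite scale1r.
have sLl := submodule_colon (iprod l) sL.
(* Two colons, because it is a product of two elements of [J] that carries [N e0] into [L]. *)
have := locally_stable_colon_prod pP sLl minP
  (locally_stable_colon_prod pP sL minP stL).
move=> [e1 /(_ (maxn e0 e1) (leq_maxr _ _))[t [Pt tN]]].
apply/Pt/JP/(acc _ (leq_maxl e0 e1)) => m Nm; apply: tN => // a la b lb e.
by apply: (@step_idealM e0); [exact: lJ|exact: lJ|apply: N_decr_le Nm; exact: leq_maxl].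
Qed.

End Chain.

(** * The chain [C_+^e M] of a Cartier module *)

Section CartierModules.
Variables (p : nat) (R : comPzRingType) (C : cartierAlgebra p R) (M : lmodType C).

Definition cimage (e : nat) : set M := actset (cplus_pow e) setT.

Lemma actset0 (A : set C) (N : set M) : actset A N 0.
Proof. by exists 0%N, (fun=> 0), (fun=> 0); split; [case|rewrite big_ord0]. Qed.

Lemma actset1 (A : set C) (N : set M) a m : A a -> N m -> actset A N (a *: m).
Proof. by move=> Aa Nm; exists 1%N, (fun=> a), (fun=> m); rewrite big_ord1. Qed.

Lemma actsetD (A : set C) (N : set M) x y :
  actset A N x -> actset A N y -> actset A N (x + y).
Proof.
move=> [n [a [m [h ->]]]] [n' [a' [m' [h' ->]]]].
exists (n + n')%N,
  (fun i => match fintype.split i with inl j => a j | inr j => a' j end),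
  (fun i => match fintype.split i with inl j => m j | inr j => m' j end); split.
  by move=> i; case: fintype.split.
rewrite big_split_ord /=; congr (_ + _); apply: eq_bigr => i _.
  by rewrite (unsplitK (inl i)).
by rewrite (unsplitK (inr i)).
Qed.

Lemma homogeneous_cplus d k : (0 < d)%N -> k \in cgrade C d -> cplus k.
Proof.
move=> d0 hk; exists d.+1, (fun e => if e == d then k else 0); split.
  by move=> e; case: eqP => [->//|_]; apply: cgrade0.
by rewrite -big_mkcond big_nat1_eq d0 ltnSn.
Qed.

Lemma cimage0 m : cimage 0 m.
Proof. by rewrite -[m]scale1r; apply: actset1. Qed.

Lemma cimageS e d k m :
  (0 < d)%N -> k \in cgrade C d -> cimage e m -> cimage e.+1 (k *: m).
Proof.
move=> d0 hk [n [a [x [h ->]]]]; rewrite scaler_sumr.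
apply: big_ind => [||i _]; [exact: actset0|exact: actsetD|].
rewrite scalerA; apply: actset1 => //; exists 1%N, (fun=> k), (fun=> a i).
rewrite big_ord1; split=> // _; split; first exact: homogeneous_cplus hk.
by have [] := h i.
Qed.

(** Reduces to homogeneous [k] of positive degree, the only ones that scalars can be moved
    across. *)
Lemma cimageS_ind e (Q : M -> Prop) : Q 0 -> (forall x y, Q x -> Q y -> Q (x + y)) ->
  (forall d k m, (0 < d)%N -> k \in cgrade C d -> cimage e m -> Q (k *: m)) ->
  forall m, cimage e.+1 m -> Q m.
Proof.
move=> Q0 QD Qk _ [n [a [x [h ->]]]]; apply: big_ind => // i _.
have [[n' [b [c [hbc ->]]]] _] := h i; rewrite scaler_suml; apply: big_ind => // j _.
have [[n'' [k [hk ->]]] cj] := hbc j.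
rewrite mulr_suml scaler_suml big_nat; apply: big_ind => // d /andP[d0 _].
by rewrite -scalerA; apply: Qk (hk d) _ => //; apply: actset1.
Qed.

Lemma cimage_scale e r m : cimage e m -> cimage e (cscal C r *: m).
Proof.
case: e => [|e]; first by move=> _; exact: cimage0.
elim/cimageS_ind => [|x y|d k x d0 hk ex]; first by rewrite scaler0; exact: actset0.
  by rewrite scalerDr; exact: actsetD.
rewrite scalerA; apply: cimageS d0 _ ex.
by rewrite -[d]add0n; apply/cgradeM/hk/cscal_in0.
Qed.

Lemma cimage_decr e : cimage e.+1 `<=` cimage e.
Proof.
elim: e => [|e ih] m; first by move=> _; exact: cimage0.
elim/cimageS_ind => [|x y|d k x d0 hk /ih ex]; [exact: actset0|exact: actsetD|].
exact: cimageS d0 hk ex.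
Qed.

(** A separate type name keeps the [R]-module structure through [cscal] apart from the [C]-module
    structure of [M]. *)
Definition restrict_scalars : Type := M.

HB.instance Definition _ := GRing.Zmodule.on restrict_scalars.

Definition restrict_scale (r : R) (m : restrict_scalars) : restrict_scalars :=
  cscal C r *: (m : M).

Fact restrict_scaleA a b m :
  restrict_scale a (restrict_scale b m) = restrict_scale (a * b) m.
Proof. by rewrite /restrict_scale scalerA rmorphM. Qed.

Fact restrict_scale1 : left_id 1 restrict_scale.
Proof. by move=> m; rewrite /restrict_scale rmorph1 scale1r. Qed.

Fact restrict_scaleDr : right_distributive restrict_scale +%R.
Proof. by move=> r x y; apply: scalerDr. Qed.

Fact restrict_scaleDl m : {morph restrict_scale^~ m : a b / a + b}.
Proof. by move=> a b; rewrite /restrict_scale rmorphD scalerDl. Qed.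

HB.instance Definition _ := GRing.Zmodule_isLmodule.Build R restrict_scalars
  restrict_scaleA restrict_scale1 restrict_scaleDr restrict_scaleDl.

Lemma fin_gen_span : fin_gen_over_base M ->
  exists g : seq restrict_scalars, forall m, span g m.
Proof.
move=> [n [g gen]]; exists [seq g i | i <- enum 'I_n] => m.
have sg := submodule_span [seq (g i : restrict_scalars) | i <- enum 'I_n].
have [a ->] := gen m; have [g0 gD gZ] := sg; apply: big_ind => // i _.
by apply/gZ/mem_span/map_f; rewrite mem_enum.
Qed.

(* The Hartshorne-Speiser-Lyubeznik-Gabber theorem for Cartier algebras.      *)
Theorem cimage_stable : (1 < p)%N -> noetherian R -> fin_gen_over_base M ->
  exists e0, forall e, (e0 <= e)%N -> cimage e = cimage e0.
Proof.
move=> p1 noethR /fin_gen_span[g gen].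
pose N e : set restrict_scalars := cimage e.
have sN e : submodule (N e).
  by split; [exact: actset0|exact: actsetD|exact: cimage_scale].
have comm d r k (m : M) : k \in cgrade C d ->
    cscal C r *: (k *: m) = k *: (cscal C (r ^+ (p ^ d)) *: m).
  by move=> hk; rewrite !scalerA (cscal_comm r hk).
apply: (chain_stable noethR gen sN cimage_decr).
  move=> e a Ja m; rewrite /N; elim/cimageS_ind => [|x y|d k x d0 hk ex].
  - by rewrite scaler0; exact: actset0.
  - by rewrite scalerDr; exact: actsetD.
  - rewrite -[_ *: _]/(cscal C a *: (k *: x)) (comm _ _ _ _ hk); apply: (cimageS d0 hk).
    have q0 : (0 < p ^ d)%N by rewrite expn_gt0 (ltnW p1).
    (* [a^q = a^(q-1) a], and [a x] already lies in [N e.+1]. *)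
    rewrite -(prednK q0) exprSr rmorphM -scalerA.
    by apply/cimage_scale/Ja.
(* Induction on [e] with [d] fixed: [b] moves [m] into [N d.+1], whose elements are sums of [k x]
   with [x] in [N d]. *)
move=> d e a b m Ja Jb; elim: e a b m Ja Jb => [|e ih] a b m Ja Jb Nm.
  exact: cimage0.
move: (b *: m) (Jb m Nm) => {Nm}m; rewrite /N.
elim/cimageS_ind => [|x y|c k x c0 hk ex].
- by rewrite scaler0; exact: actset0.
- by rewrite scalerDr; exact: actsetD.
(* [q >= 2], so [a k = k a^q] factors through [a * a].                        *)
- rewrite -[_ *: _]/(cscal C a *: (k *: x)) (comm _ _ _ _ hk); apply: (cimageS c0 hk).
  have q2 : (1 < p ^ c)%N by rewrite (leq_trans p1) // -{1}(expn1 p) leq_pexp2l // ltnW.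
  rewrite -(subnK q2) exprD mulrC expr2 !rmorphM -!scalerA.
  by apply: (ih a a) => //; apply: cimage_scale.
Qed.

End CartierModules.

(** * The module [f^!M] and its trace *)

Section UpperShriek.
Variables (p : nat) (R S : comPzRingType) (chS : Fp_algebra p S).
Variables (f : {rmorphism R -> S}) (C : cartierAlgebra p R) (M : lmodType C).

Local Notation fC := (pullback_alg f C chS).
Local Notation fM := (upper_shriek f M chS).

Lemma us_tens e k s (mu : fM) t : k \in cgrade C e ->
  ((tens f e k s : fC) *: mu) t = k *: mu (s * t ^+ (p ^ e)).
Proof. exact: us_act_tens. Qed.

Lemma us_scal s (mu : fM) t : (cscal fC s *: mu) t = mu (s * t).
Proof. by rewrite us_tens ?cgrade1 // scale1r expn0 expr1. Qed.

Lemma us_sum (I : Type) (l : seq I) (F : I -> fM) t :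
  (\sum_(i <- l) F i) t = \sum_(i <- l) F i t.
Proof. by elim: l => [|i l ih]; rewrite ?big_nil // !big_cons usD ih. Qed.

(** All [t] are needed, not just [1]: the action evaluates the previous map at [s t^q]. *)
Lemma cimage_us e (mu : fM) t : cimage e mu -> cimage e (mu t).
Proof.
elim: e mu t => [|e ih] mu t; first by move=> _; exact: cimage0.
move: mu; apply: cimageS_ind => [|mu nu|d x nu d0 hx /(ih nu) nuM].
- exact: actset0.
- by rewrite usD; exact: actsetD.
elim/pgrade_ind: x / hx => [|x y hx hy|k s hk].
- by rewrite scale0r; exact: actset0.
- by rewrite scalerDl usD; exact: actsetD.
- by rewrite us_tens //; exact: cimageS d0 hk (nuM _).
Qed.

(** If [mu] lifts [x], then [(k (x) 1) mu] lifts [k x]; surjectivity enters only at exponent [0]. *)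
Lemma cimage_Tr_surj : (forall m : M, exists mu : fM, Tr mu = m) ->
  forall e (m : M), cimage e m -> exists2 mu : fM, cimage e mu & Tr mu = m.
Proof.
move=> surj; elim=> [|e ih] m.
  by have [mu <-] := surj m; exists mu => //; exact: cimage0.
elim/cimageS_ind => [|x y [mu emu <-] [nu enu <-]|d k x d0 hk /ih[mu emu <-]].
- by exists 0; first exact: actset0.
- by exists (mu + nu); first exact: actsetD.
- exists ((tens f d k 1 : fC) *: mu); first exact/(cimageS d0 _ emu)/pgrade_tens.
  by rewrite /Tr us_tens // expr1n mulr1.
Qed.

Lemma us_sumZ (mu : fM) n (r : 'I_n -> R) (g : 'I_n -> S) :
  mu (\sum_i f (r i) * g i) = \sum_i cscal C (r i) *: mu (g i).
Proof.
have mu0 : mu 0 = 0 by rewrite -[0 in LHS](mul0r 0) -(rmorph0 f) us_scale rmorph0 scale0r.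
rewrite (big_morph mu (us_add mu) mu0).
by apply: eq_bigr => i _; rewrite us_scale.
Qed.

(* Evaluation on generators of [S] embeds [f^! M] into a finite power of [M]. *)
Lemma us_fin_gen : noetherian R -> finite_map f -> fin_gen_over_base M ->
  fin_gen_over_base fM.
Proof.
move=> noethR [n [g gen_g]] /fin_gen_span[h gen_h].
pose V : lmodType R := {ffun 'I_n -> restrict_scalars M}.
pose single (i : 'I_n) (x : restrict_scalars M) : V :=
  [ffun j => if j == i then x else 0].
pose G := [seq single i x | i <- enum 'I_n, x <- h].
have sG := submodule_span G; have [G0 GD GZ] := sG.
have single_G i x : span G (single i x).
  have [h0 hD hZ] := submodule_span h.
  apply: (@span_sub _ _ [set x | span G (single i x)] h _ _ x (gen_h x)).
    split=> [|y z Gy Gz|r y Gy] /=.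
    - suff -> : single i 0 = 0 by [].
      by apply/ffunP => j; rewrite !ffunE if_same.
    - suff -> : single i (y + z) = single i y + single i z by exact: GD.
      by apply/ffunP => j; rewrite !ffunE; case: ifP; rewrite ?addr0.
    - suff -> : single i (r *: y) = r *: single i y by exact: GZ.
      by apply/ffunP => j; rewrite !ffunE; case: ifP; rewrite ?scaler0.
  by move=> y hy; apply/mem_span/allpairs_f => //; rewrite mem_enum.
have gen_G v : span G v.
  have -> : v = \sum_i single i (v i).
    apply/ffunP => j; rewrite sum_ffunE (bigD1 j) //= ffunE eqxx big1 ?addr0 //.
    by move=> i ij; rewrite ffunE eq_sym (negPf ij).
  exact: submodule_sum.
pose L := [set v : V | exists mu : fM, forall i, v i = mu (g i)].
have sL : submodule L.
  split=> [|v w [mu muE] [nu nuE]|r v [mu muE]].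
  - by exists 0 => i; rewrite ffunE.
  - by exists (mu + nu) => i; rewrite ffunE muE nuE.
  - by exists (cscal fC (f r) *: mu) => i; rewrite ffunE us_scal us_scale -muE.
have [l lE] := submodule_fg noethR sL (fun v _ => gen_G v).
have /choice[mu muE] : forall i : 'I_(size l), exists mu : fM,
    forall j, l`_i j = mu (g j).
  by move=> i; have : L l`_i by rewrite lE; apply/mem_span/mem_nth.
exists (size l), mu => nu.
have : L [ffun j => nu (g j)] by exists nu => j; rewrite ffunE.
(* [r] acts on values as [f r] acts on [f^!M], so generators over [R] also generate over [S]. *)
rewrite lE => /span_sum[a aE]; exists (fun i => f (a i)); apply: us_ext => t.
have [b ->] := gen_g t; rewrite !us_sumZ; apply: eq_bigr => j _; congr (_ *: _).
have := congr1 (fun v : V => v j) aE; rewrite ffunE => ->.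
rewrite us_sum sum_ffunE; apply: eq_bigr => i _.
by rewrite us_scal us_scale -muE ffunE.
Qed.

End UpperShriek.

Theorem proposition5p8 (p : nat) (R S : comPzRingType)
    (chR : Fp_algebra p R) (chS : Fp_algebra p S)
    (noethR : noetherian R) (noethS : noetherian S)
    (FfinR : F_finite p R) (FfinS : F_finite p S)
    (f : {rmorphism R -> S}) (finf : finite_map f) (domf : dominant f)
    (C : cartierAlgebra p R) (M : lmodType C) (fgM : fin_gen_over_base M) :
  [set Tr mu | mu in sigma (pullback_alg f C chS) (upper_shriek f M chS)]
    `<=` sigma C M /\
  ((forall m : M, exists mu : upper_shriek f M chS, Tr mu = m) ->
   [set Tr mu | mu in sigma (pullback_alg f C chS) (upper_shriek f M chS)]
     = sigma C M).
Proof.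
have le : [set Tr mu | mu in sigma (pullback_alg f C chS) (upper_shriek f M chS)]
    `<=` sigma C M.
  by move=> _ [mu [e0 h] <-]; exists e0 => e /h; apply: cimage_us.
split=> // surj; apply/seteqP; split=> // m [e1 me1].
have p1 : (1 < p)%N by case: chR => /prime_gt1.
have fgfM := us_fin_gen chS noethR finf fgM.
have [e0 st] := cimage_stable p1 noethS fgfM.
(* Exponent [maxn e0 e1]: large enough for [m] to lie in the image, and for the lift to lie in the
   stable one. *)
have [mu emu <-] := cimage_Tr_surj surj (me1 _ (leq_maxr e0 e1)).
exists mu => //; rewrite (sigma_stable st) -[actset _ _]/(cimage e0).
by rewrite -(st _ (leq_maxl e0 e1)).
Qed.
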